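(* Let $P$ be an inflated rooted forest poset on $n\ge 2$ elements and let $x\in P$. Then $|\mathcal{T}_x(P)|\le (n-2)!$. Equality holds if and only if there is a unique minimal element $z$ of $P$ such that $z<_P x$.
   Context: All posets are finite. Let $P$ be a poset with $n$ elements. A labeling of $P$ is a bijection $L:P\to\{1,\dots,n\}$; it is natural if $x<_P y$ implies $L(x)<L(y)$. The (extended) promotion $\partial L$ of a labeling $L$ is obtained as follows: (1) repeat until the element labeled $1$ is maximal: let $u$ be the element labeled $1$ and let $v$ be the element with the smallest label among all elements $v>_P u$; swap the labels of $u$ and $v$; (2) then simultaneously replace the label $1$ by $n$ and each label $i>1$ by $i-1$. The order of $L$ is the smallest $k\ge 0$ such that $\partial^k L$ is natural (it is known that the order is always at most $n-1$). $L$ is tangled if its order equals $n-1$. For $x\in P$, $\mathcal{T}_x(P)$ denotes the set of tangled labelings $L$ of $P$ with $L(x)=n-1$. A rooted tree poset is a finite poset with a unique maximal element (the root) in which every non-root element is covered by exactly one element. A rooted forest poset is a finite disjoint union of rooted tree posets. A poset $P$ is an inflation of a poset $Q$ if there is a surjective map $\varphi:P\to Q$ such that (1) for every $q\in Q$ the subposet $\varphi^{-1}(q)$ has a unique minimal element, and (2) for all $u,v\in P$ with $\varphi(u)\ne\varphi(v)$, $u<_P v$ if and only if $\varphi(u)<_Q\varphi(v)$. An inflated rooted forest poset is an inflation of a rooted forest poset. *)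

(* Defs.v *)
From HB Require Import structures.
From mathcomp Require Import all_boot all_order all_fingroup.
Set Implicit Arguments.
Unset Strict Implicit.
Unset Printing Implicit Defensive.
Import Order.TTheory.
Local Open Scope order_scope.

(* Here A : {set T} carries the order induced by T (a subposet). *)
Section Subposets.
Context {d : Order.disp_t} {T : finPOrderType d}.
Implicit Types (A : {set T}) (x y : T).

Definition minimal_in A x : bool :=
  (x \in A) && [forall y in A, ~~ (y < x)].

Definition maximal_in A x : bool :=
  (x \in A) && [forall y in A, ~~ (x < y)].

Definition covered_by_in A x y : bool :=
  [&& x \in A, y \in A, x < y & [forall z in A, ~~ ((x < z) && (z < y))]].

Definition rooted_tree A : Prop :=
  exists r : T, unique (fun m => maximal_in A m) r /\
    forall x, x \in A -> x <> r -> exists! y, covered_by_in A x y.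

End Subposets.

(* A disjoint union of rooted trees is expressed internally, by a partition
   of Q into its summands. *)
Definition rooted_forest {d : Order.disp_t} (Q : finPOrderType d) : Prop :=
  exists F : {set {set Q}},
    [/\ partition F [set: Q],
        forall A, A \in F -> rooted_tree A
      & forall A B, A \in F -> B \in F -> A <> B ->
        forall a b, a \in A -> b \in B -> ~~ (a < b)].

Definition inflation_map {d d' : Order.disp_t} {P : finPOrderType d}
    {Q : finPOrderType d'} (phi : P -> Q) : Prop :=
  [/\ forall q, exists p, phi p = q,
      forall q, exists! m, minimal_in (phi @^-1: [set q]) m
    & forall u v, phi u <> phi v -> (u < v <-> phi u < phi v)].

Definition inflation {d d' : Order.disp_t}
    (P : finPOrderType d) (Q : finPOrderType d') : Prop :=
  exists phi : P -> Q, inflation_map phi.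

Definition inflated_rooted_forest {d : Order.disp_t} (P : finPOrderType d)
    : Prop :=
  exists (d' : Order.disp_t) (Q : finPOrderType d'),
    rooted_forest Q /\ inflation P Q.

(* A labeling takes values in 'I_n = {0, ..., n-1} rather than {1, ..., n}:
   the ordinal i stands for the label i + 1, as made explicit by [label]. *)
Notation prelabeling P := {ffun P%type -> 'I_#|P%type|}.

Section Promotion.
Context {d : Order.disp_t} {P : finPOrderType d}.
Implicit Types (L : prelabeling P) (u v x y : P).

Definition label L x : nat := (L x).+1.

(* Between sets of the same cardinality, injective means bijective. *)
Definition labeling L : bool := injectiveb L.

Lemma labelingP L : reflect (bijective L) (labeling L).
Proof.
apply: (iffP (injectiveP L)) => [injL|]; last exact: bij_inj.
by apply: inj_card_bij injL _; rewrite card_ord.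
Qed.

Definition natural L : bool :=
  [forall x, forall y, (x < y) ==> (label L x < label L y)%N].

(* One swap of step (1); the identity once the element labeled 1 is maximal. *)
Definition promotion_swap L : prelabeling P :=
  if [pick u | label L u == 1%N] is Some u then
    if [pick v | u < v] is Some v0 then
      let v := [arg min_(v < v0 | (u < v)%O) label L v]%N in
      [ffun w => L (tperm u v w)]
    else L
  else L.

(* The element labeled 1 strictly increases at each effective swap, so #|P|
   iterations of the swap reach its final state (promotion_slide_maximal). *)
Definition promotion_slide L : prelabeling P := iter #|P| promotion_swap L.

(* [ord_pred] sends 0 to n - 1 and i > 0 to i - 1. *)
Definition promotion L : prelabeling P :=
  [ffun x => ord_pred (promotion_slide L x)].

Definition has_order L (k : nat) : bool :=
  natural (iter k promotion L) &&
  [forall j : 'I_k, ~~ natural (iter j promotion L)].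

Definition tangled L : bool := labeling L && has_order L #|P|.-1.

Definition tangled_at x : {set prelabeling P} :=
  [set L | tangled L & label L x == #|P|.-1].

Lemma promotion_swap_inj L : injective L -> injective (promotion_swap L).
Proof.
rewrite /promotion_swap; case: pickP => // u _; case: pickP => // v0 _ injL.
by move=> x y; rewrite !ffunE => /injL /perm_inj.
Qed.

Lemma promotion_slide_maximal L u :
  labeling L -> label (promotion_slide L) u = 1%N -> maximal_in [set: P] u.
Proof.
move=> /injectiveP injL.
have inj k : injective (iter k promotion_swap L).
  by elim: k => //= k; apply: promotion_swap_inj.
suff inv k w : label (iter k promotion_swap L) w = 1%N ->
    maximal_in [set: P] w \/ (k <= #|[set y | (y < w)%O]|)%N.
  move=> /inv[// | le_card].
  have: [set y | (y < u)%O] \proper [set: P].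
    by rewrite properT; apply/eqP => /setP/(_ u); rewrite !inE ltxx.
  by move/proper_card; rewrite cardsT ltnNge le_card.
elim: k w => [|k IHk] w; first by right.
rewrite iterS; move: (iter k _ L) (inj k) IHk => M injM IHk.
rewrite /promotion_swap; case: pickP => [a /eqP Ma | noa Mw]; last first.
  by have := noa w; rewrite Mw.
case: pickP => [v0 av0 | maxa Mw]; last first.
  have <- : a = w by apply/injM/val_inj/succn_inj; rewrite [LHS]Ma [RHS]Mw.
  by left; rewrite /maximal_in inE; apply/forall_inP => y _; rewrite maxa.
case: arg_minnP => // v av _.
rewrite /label ffunE => Mw.
have /(canRL (tpermK a v)) : tperm a v w = a.
  by apply/injM/val_inj/succn_inj; rewrite [LHS]Mw [RHS]Ma.
rewrite tpermL => -> {w Mw}; right.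
case: (IHk a Ma) => [/andP[_ /forall_inP/(_ v (in_setT v))] | le_k].
  by rewrite av.
apply: leq_ltn_trans le_k (proper_card _); apply/properP; split.
  by apply/subsetP => y; rewrite !inE => /lt_trans; apply.
by exists a; rewrite !inE ?av ?ltxx.
Qed.

End Promotion.

(* Main.v *)
Require Import Defs.
From HB Require Import structures.
From mathcomp Require Import all_boot all_order all_fingroup.
From mathcomp Require Import zify.
Set Implicit Arguments.
Unset Strict Implicit.
Unset Printing Implicit Defensive.
Import Order.TTheory.
Local Open Scope order_scope.

(** Labels are counted from 0 to [#|P| - 1], so that the statement concerns the
    labelings whose second largest label [#|P| - 2] is at [x].  Whether such a
    labeling is tangled can be read off after [#|P| - 2] promotions.

    Each promotion lowers the labels other than 0 by one and lets them slide down
    the poset ([promotion_token]), and one more of the top labels gets sorted at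
    each step ([sorted_promotion]).  After [#|P| - 2] promotions only the labels 0 and 1
    can be in the wrong order; they come from the two largest labels.  In a
    tangled labeling the largest label never moves, because a move would sort
    one label too many ([top_promotion]).  Hence it sits at a minimal element
    [z], and tangled means that [z] is below the final position [endpos] of the
    second largest label, which is itself at most [x] ([tangled_endpos]).  If [z]
    is the only minimal element below [x], this inequality is automatic
    ([tangled_unique_minimal]), and the [(#|P| - 2)!] labelings with the two
    largest labels at [z] and [x] are all tangled.  If no minimal element is
    below [x] there are no tangled labelings.

    When several minimal elements lie below [x], the choices of [z] compete for
    the final position.  Let [D] be the part of [P] over the nodes strictly
    below a node [c] of the forest.  The elements outside [D] that are above
    some element of [D] are above all of [D]; hence promotion outside [D]
    depends only on the labels outside [D] ([promotion_agree]).  Inside [D],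
    a promotion that removes the label 0 admits one new label, into the component
    of [D] that carried 0.  Viewing an entering label as the successor
    of the one it replaces, one finds for the labelings ending in [D], that is
    with [endpos] in [D], an initial label [a], determined by the labels outside
    [D] and different from the largest one, such that [endpos] is in the
    component of [D] that initially carries [a] ([endpos_origin]).

    Consequently, exchanging the labels at [zb] in a component [B] and at [z] in
    another component maps the labelings with largest label at [zb] that end in
    [B] injectively to labelings with largest label at [z] that end in [B]
    ([swap_endpos]), but misses those where [a] is at [zb] ([swap_missed]).  For
    fixed [z], the labelings ending in different components are disjoint.  So
    the contributions of all components together are at most the number of
    labelings with the two largest labels at fixed places, and fewer as soon as
    there are two components; [candidates_bound] is the resulting induction
    down the forest. *)

(** * Extremal elements *)

Lemma ex_maximal_above {d : Order.disp_t} {T : finPOrderType d} (p : pred T) a :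
  p a -> exists b, [/\ p b, a <= b & forall c, b < c -> ~~ p c].
Proof.
move=> pa; pose q : pred T := fun b => p b && (a <= b).
have qa : q a by rewrite /q pa lexx.
case: (arg_maxnP (fun b : T => #|[set y | y < b]|) qa) => b /andP[pb ab] maxb.
exists b; split=> // c bc; apply/negP => pc.
have := maxb c; rewrite /q pc (le_trans ab (ltW bc)) => /(_ isT).
apply/negP; rewrite -ltnNge; apply/proper_card/properP; split.
  by apply/subsetP => y; rewrite !inE => /lt_trans; apply.
by exists b; rewrite !inE ?ltxx.
Qed.

Lemma ex_minimal_below {d : Order.disp_t} {T : finPOrderType d} (p : pred T) a :
  p a -> exists b, [/\ p b, b <= a & forall c, c < b -> ~~ p c].
Proof. exact: (@ex_maximal_above _ (T^d)%type). Qed.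

(** * One promotion step *)

Section Promotion.
Context {d : Order.disp_t} {P : finPOrderType d}.
Implicit Types (L K : prelabeling P) (u v w x y z : P).

(** The element that the label 0 moves to from [v], or [v] itself when [v] is
    maximal.  The labels above the current position are not changed by earlier
    swaps, so the elements visited by 0 are the iterates of [next L] for the
    initial labeling [L], and lying on the sliding path from [u] can be written
    [fconnect (next L) u]. *)
Definition next L v : P :=
  if [pick w | v < w] is Some v0
  then [arg min_(w < v0 | (v < w)%O) label L w]%N else v.

Lemma nextP L v :
  (next L v = v /\ forall w, ~~ (v < w)) \/
  (v < next L v /\ forall w, v < w -> (L (next L v) <= L w)%N).
Proof.
rewrite /next; case: pickP => [v0 vv0 | maxv]; last by left; split=> // w; rewrite maxv.
by right; case: arg_minnP.
Qed.

Lemma next_ge L v : v <= next L v.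
Proof. by case: (nextP L v) => [[-> _] | [/ltW]]. Qed.

Lemma next_gt L v w : v < w -> v < next L v.
Proof. by case: (nextP L v) => [[_ /(_ w)/negP] | []]. Qed.

Lemma next_min L v w : v < w -> (L (next L v) <= L w)%N.
Proof. by case: (nextP L v) => [[_ /(_ w)/negP] | [_]]; last exact. Qed.

Lemma sliding_ge L u w : fconnect (next L) u w -> u <= w.
Proof.
move/iter_findex => <-; elim: (findex _ _ _) => //= i IHi.
exact: le_trans IHi (next_ge _ _).
Qed.

Lemma sliding_next L u w :
  fconnect (next L) u w -> fconnect (next L) u (next L w).
Proof. by move=> /connect_trans; apply; apply: fconnect1. Qed.

Lemma sliding_chain L u v w :
  fconnect (next L) u v -> fconnect (next L) u w ->
  fconnect (next L) v w \/ fconnect (next L) w v.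
Proof.
move=> /iter_findex <- /iter_findex <-.
move: (findex _ _ _) (findex _ _ _) => i j.
by case: (leqP i j) => [/subnK <- | /ltnW/subnK <-]; [right | left];
  rewrite iterD; apply: fconnect_iter.
Qed.

Lemma sliding_step L u v :
  fconnect (next L) u v -> v = u \/ fconnect (next L) (next L u) v.
Proof.
move/iter_findex => <-; case: (findex _ _ _) => [|i]; first by left.
by right; rewrite iterSr; apply: fconnect_iter.
Qed.

Lemma sliding_prev L u v :
  fconnect (next L) u v ->
  v = u \/ exists w, [/\ fconnect (next L) u w, w < v & next L w = v].
Proof.
move/iter_findex => <-; elim: (findex _ _ _) => [|i]; first by left.
set w := iter i _ u => IHw; rewrite iterS -/w.
have uw : fconnect (next L) u w by apply: fconnect_iter.
case: (nextP L w) => [[-> _] // | [w_lt _]]; right.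
by exists w.
Qed.

Lemma iter_swap_inj L k : injective L -> injective (iter k promotion_swap L).
Proof. by move=> injL; elim: k => //= k; apply: promotion_swap_inj. Qed.

Lemma promotion_swapE L u : injective L -> L u = 0 :> nat ->
  promotion_swap L = [ffun w => L (tperm u (next L u) w)].
Proof.
move=> injL Lu; rewrite /promotion_swap.
case: pickP => [u' /eqP[] Lu'|/(_ u)]; last first.
  by rewrite /label Lu.
have -> : u' = u by apply/injL/val_inj; rewrite /= Lu'.
rewrite /next; case: pickP => // _.
by apply/ffunP => w; rewrite ffunE tperm1 perm1.
Qed.

Lemma promotion_slideE L u w : labeling L -> L u = 0 :> nat ->
  promotion_slide L w = (if fconnect (next L) u w then
    if next L w == w then 0 else L (next L w) else L w) :> nat.
Proof.
move=> labL Lu; have /injectiveP injL := labL.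
(* After k swaps the label 0 sits at t, and exactly the elements of the
   sliding path below t have received the label of their successor. *)
have inv k : exists t, [/\ fconnect (next L) u t,
    iter k promotion_swap L t = 0 :> nat &
    forall v, v != t -> iter k promotion_swap L v =
      if fconnect (next L) u v && (v < t) then L (next L v) else L v].
  elim: k => [|k [t [ut Kt Kv]]].
    exists u; split=> // v _ /=; case: ifP => // /andP[/sliding_ge uv].
    by move/(le_lt_trans uv); rewrite ltxx.
  have nextK : next (iter k promotion_swap L) t = next L t.
    have injK := @iter_swap_inj L k injL; move: Kt Kv injK.
    move: (iter _ _ _) => K Kt Kv injK.
    have KL v : t < v -> K v = L v.
      by move=> tv; rewrite Kv ?gt_eqF // [v < t]lt_gtF // andbF.
    case: (nextP L t) => [[-> maxt]|[t_lt minL]].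
      by case: (nextP K t) => [[-> //]|[]]; rewrite (negPf (maxt _)).
    apply/injL/val_inj/eqP; rewrite eqn_leq -!KL ?(next_gt _ t_lt) //.
    rewrite (next_min K) ?t_lt //= !KL ?(next_gt _ t_lt) //.
    by rewrite next_min // (next_gt _ t_lt).
  rewrite iterS (promotion_swapE (iter_swap_inj (k := k) injL) Kt) nextK.
  exists (next L t); split=> [||v neq]; first exact: sliding_next.
    by rewrite ffunE tpermR.
  rewrite ffunE; case: (eqVneq v t) neq => [->|neq'] neq.
    rewrite tpermL ut; case: (nextP L t) => [[nt _]|[t_lt _]].
      by rewrite nt eqxx in neq.
    by rewrite t_lt Kv ?gt_eqF // [next L t < t]lt_gtF // andbF.
  rewrite tpermD 1?eq_sym // Kv //; congr (if _ then _ else _).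
  case uv: (fconnect _ u v) => //=.
  case: (sliding_chain ut uv) => [/sliding_step | /sliding_ge vt].
    case=> [/eqP|/sliding_ge ntv]; first by rewrite (negPf neq').
    by rewrite !le_gtF // (le_trans (next_ge L t)).
  have vt' : v < t by rewrite lt_neqAle neq' vt.
  by rewrite vt' (lt_le_trans vt' (next_ge _ _)).
have [t [ut Kt Kv]] := inv #|P|; rewrite /promotion_slide.
have maxt v : ~~ (t < v).
  have := @promotion_slide_maximal _ _ L t labL.
  by rewrite /label Kt => /(_ erefl)/andP[_ /forall_inP]; apply; rewrite inE.
have nt : next L t = t by case: (nextP L t) => [[]|[]] //; rewrite (negPf (maxt _)).
case: (eqVneq w t) => [->|neq]; first by rewrite Kt ut nt eqxx.
rewrite Kv //; case uw: (fconnect _ u w) => //=.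
have tw v : fconnect (next L) t v -> v = t.
  by move/sliding_ge; rewrite le_eqVlt (negPf (maxt _)) orbF => /eqP.
case: (sliding_chain ut uw) => [/tw/eqP|/sliding_step[/esym/eqP|nwt]].
- by rewrite (negPf neq).
- by rewrite (negPf neq).
have wt : w < t.
  by rewrite lt_neqAle neq (le_trans (next_ge L w) (sliding_ge nwt)).
by rewrite wt gt_eqF // (next_gt _ wt).
Qed.

Lemma ord_predE n (i : 'I_n) : ord_pred i = (if i == 0 :> nat then n.-1 else i.-1) :> nat.
Proof.
case: n i => [[]//|n] i /=; case: i => -[|i] /= lti.
  by rewrite modn_small.
by rewrite modnDr modn_small // ltnW.
Qed.

Lemma labeling_promotion L : labeling L -> labeling (promotion L).
Proof.
move=> /injectiveP injL; apply/injectiveP => x y; rewrite !ffunE.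
by move=> /ord_pred_inj; apply: iter_swap_inj.
Qed.

Lemma labeling_iter_promotion L k : labeling L -> labeling (iter k promotion L).
Proof. by move=> labL; elim: k => //= k; apply: labeling_promotion. Qed.

Lemma label_inj L v w : labeling L -> L v = L w :> nat -> v = w.
Proof. by move=> /injectiveP injL /val_inj/injL. Qed.

Lemma labeling_surj L i : labeling L -> (i < #|P|)%N -> exists u, L u = i :> nat.
Proof.
move=> /labelingP[g _ gK] lti; exists (g (Ordinal lti)).
by rewrite gK.
Qed.

Lemma promotionE L u w : labeling L -> L u = 0 :> nat ->
  promotion L w = (if fconnect (next L) u w then
    if next L w == w then #|P|.-1 else (L (next L w)).-1 else (L w).-1) :> nat.
Proof.
move=> labL Lu; rewrite ffunE ord_predE (promotion_slideE w labL Lu).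
have neq0 v : v != u -> L v != 0 :> nat.
  by apply: contra => /eqP Lv; apply/eqP/(label_inj labL); rewrite Lu Lv.
case: (boolP (fconnect _ u w)) => [/sliding_ge uw|uw].
  case: (eqVneq (next L w) w) => // neq; rewrite (negPf (neq0 _ _)) //.
  by rewrite gt_eqF // (le_lt_trans uw) // lt_neqAle eq_sym neq next_ge.
rewrite (negPf (neq0 _ _)) //; apply: contraNneq uw => ->.
exact: connect0.
Qed.

Lemma sliding_next_gt0 L u w : labeling L -> L u = 0 :> nat ->
  fconnect (next L) u w -> next L w != w -> (0 < L (next L w))%N.
Proof.
move=> labL Lu /sliding_ge uw nw; rewrite lt0n.
apply: contraNneq nw => Ln; have nu : next L w = u by apply: (label_inj labL); rewrite Ln.
by rewrite eq_le next_ge nu uw.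
Qed.

(** Labels other than the smallest one only ever move down the poset. *)
Lemma promotion_token L w m : labeling L -> L w = m.+1 :> nat ->
  exists2 v, v <= w & promotion L v = m :> nat.
Proof.
move=> labL Lw; have [u Lu] : exists u, L u = 0 :> nat.
  by apply: labeling_surj => //; apply: leq_ltn_trans (ltn_ord (L w)).
case uw: (fconnect (next L) u w); last first.
  by exists w => //; rewrite (promotionE w labL Lu) uw Lw.
case: (sliding_prev uw) => [wu|[v [uv vw nv]]]; first by rewrite -wu Lw in Lu.
exists v; first exact: ltW.
by rewrite (promotionE v labL Lu) uv nv gt_eqF // Lw.
Qed.

Lemma iter_promotion_token L w m k : labeling L -> L w = (m + k)%N :> nat ->
  exists2 v, v <= w & iter k promotion L v = m :> nat.
Proof.
move=> labL; elim: k m => [|k IHk] m; first by rewrite addn0; exists w.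
rewrite addnS -addSn => /IHk[v vw Lv].
have [v' v'v <-] := promotion_token (labeling_iter_promotion k labL) Lv.
by exists v' => //; apply: le_trans vw.
Qed.


(** * Sorted top labels *)

(** Equivalently, the elements with label at least [a] form an upper set on
    which the labeling is natural. *)
Definition sorted_from L a := forall u v, u < v -> (a <= L u)%N -> (L u < L v)%N.

(** Along the sliding path, [u] receives the smallest label above it, so it is
    correctly placed whatever its old label was; off the path it keeps its
    label, and the hypothesis on [L u] is needed. *)
Lemma promotion_lt L u v : labeling L -> u < v ->
  (L u = (promotion L u).+1 :> nat -> forall w, u < w -> (L u < L w)%N) ->
  (promotion L u < promotion L v)%N.
Proof.
move=> labL uv low; have [z Lz] : exists z, L z = 0 :> nat.
  by apply: labeling_surj => //; apply: leq_ltn_trans (ltn_ord (L u)).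
have [v' vv' ge_v'] : exists2 v', v <= v' & ((L v').-1 <= promotion L v)%N.
  rewrite (promotionE v labL Lz); case: ifP => _; last by exists v.
  case: ifP => _; last by exists (next L v); rewrite ?next_ge.
  exists v => //; have := ltn_ord (L v); lia.
have uv' : u < v' := lt_le_trans uv vv'.
rewrite ltn_neqAle; apply/andP; split.
  apply/eqP => /(label_inj (labeling_promotion labL)) eq_uv; by rewrite eq_uv ltxx in uv.
apply: leq_trans ge_v'; move: low; rewrite (promotionE u labL Lz).
have nu := next_gt L uv; rewrite (gt_eqF nu).
case: (boolP (fconnect _ z u)) => [_ _|zu].
  by have := next_min L uv'; lia.
have Lu : (0 < L u)%N.
  rewrite lt0n; apply: contraNneq zu => Lu.
  by rewrite (@label_inj L u z) ?Lz ?connect0.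
by rewrite prednK // => /(_ erefl v' uv'); lia.
Qed.

(** One more label gets sorted at each step: the label [a] of [promotion L] was
    either [a.+1] in [L], hence sorted, or taken along the sliding path. *)
Lemma sorted_promotion L a :
  labeling L -> sorted_from L a.+1 -> sorted_from (promotion L) a.
Proof.
move=> labL sortL u v uv le_a; apply: promotion_lt => // eq_u w uw.
by apply: sortL; rewrite ?eq_u.
Qed.

Lemma sorted_iter_promotion L a k : labeling L -> (#|P| <= a + k)%N ->
  sorted_from (iter k promotion L) a.
Proof.
move=> labL; elim: k a => [|k IHk] a le_a.
  rewrite addn0 in le_a => u v _ /(leq_trans le_a).
  by rewrite leqNgt ltn_ord.
by apply: sorted_promotion; [apply: labeling_iter_promotion | apply: IHk; lia].
Qed.

Lemma naturalP L : labeling L -> reflect (sorted_from L 1) (natural L).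
Proof.
move=> labL; apply: (iffP forallP) => [nat u v uv _|sortL u].
  by have /forallP/(_ v)/implyP/(_ uv) := nat u; rewrite /label ltnS.
apply/forallP => v; apply/implyP => uv; rewrite /label ltnS.
have [/eqP Lu|Lu] := posnP (L u); last exact: sortL.
rewrite (eqP Lu) lt0n; apply: contraTneq uv => Lv.
by rewrite (@label_inj L v u) ?ltxx // Lv (eqP Lu).
Qed.

Lemma natural_promotion L : labeling L -> natural (iter #|P|.-1 promotion L).
Proof.
move=> labL; apply/naturalP; first exact: labeling_iter_promotion.
by apply: sorted_iter_promotion => //; lia.
Qed.

(** If the largest label moves from [z] down to [r], then [z] carried the
    smallest label above [r], so [r] is already correctly placed: the sorting
    gains one step. *)
Lemma top_promotion L z m : labeling L -> L z = m.+1 :> nat ->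
  sorted_from L m.+2 ->
  promotion L z = m :> nat \/ sorted_from (promotion L) m.
Proof.
move=> labL Lz sortL; have [r rz Lr] := promotion_token labL Lz.
case: (eqVneq r z) Lr => [-> ->|neq Lr]; [by left | right] => u v uv.
rewrite leq_eqVlt => /orP[/eqP Lu|]; last exact: sorted_promotion.
have ur : u = r by apply: (label_inj (labeling_promotion labL)); rewrite Lr.
apply: promotion_lt => //; rewrite -Lu ur => Lr'.
by move: neq; rewrite (@label_inj L r z) ?eqxx // Lr'.
Qed.

Lemma top_stays_or_sorted L z m k : labeling L -> (m + k).+1 = #|P| ->
  L z = #|P|.-1 :> nat ->
  iter k promotion L z = m :> nat \/ sorted_from (iter k promotion L) m.
Proof.
move=> labL; elim: k m => [|k IHk] m cardP Lz; first by left; rewrite /= Lz; lia.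
have labk := labeling_iter_promotion k labL.
case: (IHk m.+1) => [||Lk|sortL] //; first by rewrite addSnnS.
  by apply: top_promotion => //; apply: sorted_iter_promotion => //; lia.
by right; apply: sorted_promotion.
Qed.

(** * Tangled labelings through their last unsorted stage *)

(** The position after [#|P| - 2] promotions of the label that starts as
    [#|P| - 2]; [x] serves as the default value of the pick. *)
Definition endpos x L : P :=
  odflt x [pick w | iter #|P|.-2 promotion L w == 0 :> nat].

Lemma endposE x L e : labeling L ->
  iter #|P|.-2 promotion L e = 0 :> nat -> endpos x L = e.
Proof.
move=> labL Le; rewrite /endpos; case: pickP => [w /eqP Lw|/(_ e)]; last by rewrite Le.
by apply: (label_inj (labeling_iter_promotion #|P|.-2 labL)); rewrite Lw.
Qed.

Lemma endposP x L : labeling L -> iter #|P|.-2 promotion L (endpos x L) = 0 :> nat.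
Proof.
move=> labL; have [|e Le] := labeling_surj (labeling_iter_promotion #|P|.-2 labL) (i := 0).
  by apply/card_gt0P; exists x.
by rewrite (endposE x labL Le).
Qed.

(** By then every label from 2 on is sorted, so only the label 1 can lie below
    the label 0. *)
Lemma below_endpos x L u v : (2 <= #|P|)%N -> labeling L ->
  u < endpos x L -> v < endpos x L -> u = v.
Proof.
move=> cardP labL; have Ke := endposP x labL.
have labK := labeling_iter_promotion #|P|.-2 labL.
have sortK : sorted_from (iter #|P|.-2 promotion L) 2.
  by apply: sorted_iter_promotion => //; lia.
move: (endpos x L) (iter _ _ L) Ke labK sortK => e K Ke labK sortK.
have below w : w < e -> K w = 1 :> nat.
  move=> we; have Kw : (K w < 2)%N by rewrite ltnNge; apply/negP => /(sortK _ _ we); lia.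
  suff : K w != 0 :> nat by lia.
  by apply: contraTneq we => Kw0; rewrite (@label_inj K w e) ?ltxx // Kw0.
by move=> /below Ku /below Kv; apply: (label_inj labK); rewrite Ku.
Qed.

Definition prescribed z x : {set prelabeling P} :=
  [set L | [&& labeling L, L z == #|P|.-1 :> nat & L x == #|P|.-2 :> nat]].

Lemma endpos_le z x L : (2 <= #|P|)%N -> L \in prescribed z x -> endpos x L <= x.
Proof.
move=> cardP; rewrite inE => /and3P[labL _ /eqP Lx].
have [|e ex Le] := @iter_promotion_token L x 0 #|P|.-2 labL; first by rewrite Lx.
by rewrite (endposE x labL Le).
Qed.

(** After [#|P| - 2] promotions, all labels but 0 and 1 are sorted; if the
    labeling is not natural at that time, then 1 is below 0.  The label 1 is then
    the former largest label, which cannot have moved. *)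
Lemma tangled_endpos x L : (2 <= #|P|)%N -> L \in tangled_at x ->
  exists z, [/\ minimal_in [set: P] z, L \in prescribed z x & z < endpos x L].
Proof.
move=> cardP; rewrite !inE => /andP[/andP[labL /andP[_ /forallP not_natj]] Lx].
have lt_j : (#|P|.-2 < #|P|.-1)%N by lia.
set K := iter #|P|.-2 promotion L.
have not_nat : ~~ natural K := not_natj (Ordinal lt_j).
have labK : labeling K by apply: labeling_iter_promotion.
have [|z Lz] := @labeling_surj L #|P|.-1 labL; first lia.
have sortK : sorted_from K 2 by apply: sorted_iter_promotion => //; lia.
have Kz : K z = 1 :> nat.
  case: (@top_stays_or_sorted L z 1 #|P|.-2 labL) => //; first by lia.
  by move/(naturalP labK); rewrite (negPf not_nat).
have ze : z < endpos x L.
  case/forallPn: not_nat => u /forallPn[v]; rewrite negb_imply /label ltnS => /andP[uv].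
  rewrite -leqNgt => le_vu.
  have lt_vu : (K v < K u)%N.
    rewrite ltn_neqAle le_vu andbT; apply/eqP => /(label_inj labK) eq_vu.
    by rewrite eq_vu ltxx in uv.
  have Ku : K u = 1 :> nat.
    case: (leqP 2 (K u)) => [/(sortK _ _ uv)|]; lia.
  have -> : z = u by apply: (label_inj labK); rewrite Ku.
  have Kv : K v = 0 :> nat by apply/eqP; rewrite -leqn0 -ltnS -Ku.
  by rewrite (endposE x labL Kv).
exists z; split=> //; last first.
  have Lx' : L x = #|P|.-2 :> nat := congr1 predn (eqP Lx).
  by rewrite inE labL Lz Lx' !eqxx.
rewrite /minimal_in inE; apply/forallP => r; apply/implyP => _; apply/negP => rz.
have re := lt_trans rz ze.
by move: rz; rewrite (below_endpos cardP labL re ze) ltxx.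
Qed.

(** Until the second largest label has become 0, it stays in the down-set of
    [x], whose only minimal element is [z]; it is thus above the largest label,
    which is stuck at [z]. *)
Lemma tangled_unique_minimal z x L : (2 <= #|P|)%N ->
  minimal_in [set: P] z -> z < x ->
  (forall w, minimal_in [set: P] w -> w < x -> w = z) ->
  L \in prescribed z x -> L \in tangled_at x.
Proof.
move=> cardP minz zx uniz; rewrite !inE => /and3P[labL /eqP Lz /eqP Lx].
rewrite /tangled labL /has_order natural_promotion // /label Lx.
apply/andP; split; last by apply/eqP; lia.
apply/forallP => j; set K := iter j promotion L.
have labK : labeling K by apply: labeling_iter_promotion.
have lt_j := ltn_ord j; have minz' w : ~~ (w < z).
  by case/andP: minz => _ /forall_inP; apply; rewrite inE.
have Kz : K z = (#|P|.-1 - j)%N :> nat.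
  have [|w wz Kw] := @iter_promotion_token L z (#|P|.-1 - j) j labL.
    by rewrite Lz; lia.
  by move: wz Kw; rewrite le_eqVlt (negPf (minz' _)) orbF => /eqP ->.
have [|y yx Ky] := @iter_promotion_token L x (#|P|.-2 - j) j labL.
  by rewrite Lx; lia.
have zy : z < y.
  have [m [_ my minm]] := @ex_minimal_below _ P xpredT y isT.
  have minm' : minimal_in [set: P] m.
    by rewrite /minimal_in inE; apply/forall_inP => w _; apply/negP => /minm.
  have mx : m <= x := le_trans my yx.
  have mz : m = z.
    apply: uniz => //; rewrite lt_neqAle mx andbT.
    by apply/eqP => mx'; move: (minm z); rewrite mx' zx => /(_ isT).
  rewrite lt_neqAle -mz my andbT; apply/eqP => my'.
  by move: Ky; rewrite -my' mz -/K Kz; lia.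
by apply/negP => /(naturalP labK)/(_ z y zy); rewrite Kz Ky; lia.
Qed.


(** * Rearranging labels *)

Definition relabel (s : {perm P}) L : prelabeling P := [ffun w => L (s w)].

Lemma relabel_labeling s L : labeling L -> labeling (relabel s L).
Proof.
move=> /injectiveP injL; apply/injectiveP => v w; rewrite !ffunE.
by move=> /injL/perm_inj.
Qed.

Lemma relabel_inj s : injective (relabel s).
Proof.
move=> L K /ffunP eqLK; apply/ffunP => w.
by have := eqLK ((s^-1)%g w); rewrite !ffunE permKV.
Qed.

Lemma prescribed_nonempty z x :
  (2 <= #|P|)%N -> z != x -> exists L, L \in prescribed z x.
Proof.
move=> cardP zx; pose E : prelabeling P := [ffun w => enum_rank w].
have labE : labeling E.
  by apply/injectiveP => v w; rewrite !ffunE => /enum_rank_inj.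
have [|p Ep] := @labeling_surj E #|P|.-1 labE; first by lia.
have [|q Eq] := @labeling_surj E #|P|.-2 labE; first by lia.
pose s := (tperm z p * tperm (tperm z p x) q)%g.
have sx : s x = q by rewrite /s permM tpermL.
have sz : s z = p.
  rewrite /s permM tpermL tpermD //.
    by rewrite -[X in _ != X](tpermL z p) (inj_eq perm_inj) eq_sym.
  by apply/eqP => qp; move: Eq; rewrite qp Ep; lia.
exists (relabel s E); rewrite inE relabel_labeling //=.
rewrite /relabel !(ffunE (fun w => E (s w))).
by rewrite sx sz Ep Eq !eqxx.
Qed.

(** The permutations that fix [z] and [x] act simply transitively on these
    labelings. *)
Lemma card_prescribed z x :
  (2 <= #|P|)%N -> z != x -> #|prescribed z x| = (#|P| - 2)`!.
Proof.
move=> cardP zx; have [L0] := prescribed_nonempty cardP zx.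
rewrite inE => /and3P[labL0 /eqP L0z /eqP L0x].
have [g L0K gK] := labelingP _ labL0.
pose A := ~: [set z; x].
have -> : prescribed z x = [set relabel s L0 | s in perm_on A].
  apply/setP => L; apply/idP/imsetP => [|[s sA ->]].
    rewrite inE => /and3P[labL /eqP Lz /eqP Lx].
    have inj_gL : injective (g \o L).
      by apply: inj_comp (can_inj gK) _; apply/injectiveP.
    exists (perm inj_gL); last by apply/ffunP => w; rewrite ffunE permE /= gK.
    apply/subsetP => w; rewrite !inE permE /= negb_or; apply: contraNT.
    rewrite negb_and !negbK => /orP[]/eqP ->; apply/eqP/(label_inj labL0).
      by rewrite gK Lz L0z.
    by rewrite gK Lx L0x.
  rewrite inE relabel_labeling //= /relabel !(ffunE (fun w => L0 (s w))).
  by rewrite !(out_perm sA) ?inE ?eqxx ?orbT // L0z L0x !eqxx.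
rewrite card_in_imset; last first.
  move=> s t _ _ /ffunP eq_st; apply/permP => w.
  by have := eq_st w; rewrite !ffunE => /(can_inj L0K).
by rewrite card_perm /A cardsCs setCK cards2 zx.
Qed.

(** * Promotion outside and inside a module *)

Definition lower_module (D : {set P}) : Prop :=
  (forall u v, u < v -> v \in D -> u \in D) /\
  (forall u v w, u \in D -> u < v -> v \notin D -> w \in D -> w < v).

(** Equivalently, [B] meets [D] in a union of connected components. *)
Definition separated (D B : {set P}) : Prop :=
  forall u v, u \in D -> v \in D -> u < v -> (u \in B) = (v \in B).

Definition agree_outside (D : {set P}) L K : Prop :=
  forall w, w \notin D -> L w = K w.

Lemma agree_outside_sym D L K : agree_outside D L K -> agree_outside D K L.
Proof. by move=> eqLK w /eqLK. Qed.

Lemma module_le D u v : lower_module D -> u <= v -> v \in D -> u \in D.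
Proof. by move=> [downD _]; rewrite le_eqVlt => /predU1P[->|/downD]; last exact. Qed.

Lemma next_agree D L K v : lower_module D -> labeling L ->
  agree_outside D L K -> v \notin D -> next L v = next K v.
Proof.
move=> modD labL eqLK vD.
have aboveD w : v < w -> w \notin D.
  by move=> /ltW vw; apply: contra vD; apply: module_le.
case: (nextP K v) => [[-> maxv]|[vK minK]].
  by case: (nextP L v) => [[]|[]] //; rewrite (negPf (maxv _)).
have vL := next_gt L vK; apply: (label_inj labL); apply/eqP.
by rewrite eqn_leq next_min //= !eqLK ?aboveD // minK.
Qed.

(** A path that starts in [D] and leaves it does so at the element of smallest
    label above [D], whichever element of [D] it starts from; from there on it
    only sees labels outside [D]. *)
Lemma sliding_agree D L K u u' w : lower_module D -> labeling L -> labeling K ->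
  agree_outside D L K -> L u = 0 :> nat -> K u' = 0 :> nat -> w \notin D ->
  fconnect (next L) u w -> fconnect (next K) u' w.
Proof.
move=> modD labL labK eqLK Lu Ku' wD /iter_findex; move: (findex _ _ _) => i.
elim: i w wD => [|i IHi] w wD /= eq_w.
  by rewrite (@label_inj K u' w) ?connect0 // -(eqLK w) // -eq_w Ku' Lu.
move: eq_w; set s := iter i _ u => eq_w.
have [sD|sD] := boolP (s \in D); last first.
  rewrite -eq_w (next_agree modD labL eqLK sD).
  by apply: sliding_next; apply: IHi.
have us : fconnect (next L) u s by apply: fconnect_iter.
have sw : s < w.
  by rewrite lt_neqAle -{2}eq_w next_ge andbT; apply: contraNneq wD => <-.
have uD : u \in D := module_le modD (sliding_ge us) sD.
have u'D : u' \in D.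
  apply: contraTT uD => u'D.
  by rewrite (@label_inj L u u') // Lu eqLK.
(* The last element of the other path inside D steps to the element of
   smallest label above D, which is w. *)
have [|t [/andP[tD ut] _ maxt]] :=
  @ex_maximal_above _ P (fun t => (t \in D) && fconnect (next K) u' t) u'.
  by rewrite u'D connect0.
have tw : t < w by have [_ /(_ s w t)] := modD; apply.
have nt := next_gt K tw; have nut := sliding_next ut.
have ntD : next K t \notin D by have := maxt _ nt; rewrite nut andbT.
suff -> : w = next K t by [].
have snt : s < next K t by have [_ /(_ t _ s)] := modD; apply.
apply: (label_inj labL); apply/eqP; rewrite eqn_leq -{1}eq_w next_min //=.
by rewrite !eqLK // next_min.
Qed.

Lemma promotion_agree D L K : lower_module D -> labeling L -> labeling K ->
  agree_outside D L K -> agree_outside D (promotion L) (promotion K).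
Proof.
move=> modD labL labK eqLK w wD; apply: val_inj => /=.
have P_gt0 : (0 < #|P|)%N by apply/card_gt0P; exists w.
have [u Lu] := labeling_surj labL P_gt0; have [u' Ku'] := labeling_surj labK P_gt0.
rewrite (promotionE w labL Lu) (promotionE w labK Ku').
have -> : fconnect (next L) u w = fconnect (next K) u' w.
  apply/idP/idP; first exact: (sliding_agree modD labL labK eqLK).
  exact: (sliding_agree modD labK labL (agree_outside_sym eqLK)).
rewrite -(next_agree modD labL eqLK wD) !eqLK //.
by apply: contra wD; apply: module_le => //; apply: next_ge.
Qed.

(** [o] sends a label after the promotion to the label, before it, of the slot
    it belongs to: the label increased by one if that was already in [D], and
    otherwise 0, the label it replaces.  The labels of [D] are those missing
    outside [D], so [o] does not depend on [K]; and a slot keeps its component,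
    because the part of the sliding path inside [D] is connected. *)
Lemma promotion_origin D L : lower_module D -> labeling L ->
  exists o : nat -> nat, (forall i m, o i = m.+1 -> i = m) /\
  forall K, labeling K -> agree_outside D L K ->
  forall w, w \in D -> exists v, [/\ v \in D, K v = o (promotion K w) :> nat &
    forall B, separated D B -> (v \in B) = (w \in B)].
Proof.
move=> modD labL.
pose o i := if [exists v in D, L v == i.+1 :> nat] then i.+1 else 0.
exists o; split=> [i m|K labK eqLK w wD]; first by rewrite /o; case: ifP => // _ [].
have P_gt0 : (0 < #|P|)%N by apply/card_gt0P; exists w.
have [u Ku] := labeling_surj labK P_gt0.
have oldlabel v : v \in D -> (0 < K v)%N -> K v = o (K v).-1 :> nat.
  move=> vD Kv; rewrite /o prednK // ifT //.
  have [v' Lv'] := labeling_surj labL (ltn_ord (K v)).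
  apply/exists_inP; exists v'; last exact/eqP.
  apply: contraTT vD => v'D; rewrite (@label_inj K v v') //.
  by rewrite -(eqLK v') // Lv'.
have newlabel i : (forall v, v \in D -> L v != i.+1 :> nat) -> o i = 0.
  by move=> newi; rewrite /o ifN //; apply/exists_inPn.
rewrite (promotionE w labK Ku).
have [uw|uw] := boolP (fconnect _ u w); last first.
  exists w; split=> //; apply: oldlabel => //.
  rewrite lt0n; apply: contraNneq uw => Kw.
  by rewrite (@label_inj K w u) ?connect0 // Kw Ku.
have uD : u \in D := module_le modD (sliding_ge uw) wD.
have uwB B : separated D B -> (u \in B) = (w \in B).
  have := sliding_ge uw; rewrite le_eqVlt => /predU1P[-> //|lt_uw sepB].
  exact: sepB.
case: (eqVneq (next K w) w) => [_|nw].
  exists u; split=> //; rewrite newlabel // prednK // => v _.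
  by rewrite neq_ltn ltn_ord.
have lt_nw : w < next K w by rewrite lt_neqAle eq_sym nw next_ge.
have [nD|nD] := boolP (next K w \in D).
  exists (next K w); split=> //.
    by apply: oldlabel => //; apply: (sliding_next_gt0 labK Ku uw nw).
  by move=> B sepB; rewrite (sepB w (next K w)).
exists u; split=> //; rewrite newlabel // => v vD.
rewrite prednK ?(sliding_next_gt0 labK Ku uw nw) // -eqLK //.
by apply: contraNneq nD => /(label_inj labL) <-.
Qed.

Lemma iter_promotion_agree D L K k : lower_module D -> labeling L -> labeling K ->
  agree_outside D L K ->
  agree_outside D (iter k promotion L) (iter k promotion K).
Proof.
move=> modD labL labK eqLK; elim: k => //= k IHk.
by apply: promotion_agree => //; apply: labeling_iter_promotion.
Qed.

(** A label [m >= k] is still present after [k] steps, as [m - k]; the first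
    property says that no other label belongs to its slot. *)
Lemma iter_promotion_origin D L k : lower_module D -> labeling L ->
  exists o : nat -> nat, (forall i m, o i = m -> (k <= m)%N -> (i + k)%N = m) /\
  forall K, labeling K -> agree_outside D L K ->
  forall w, w \in D -> exists v, [/\ v \in D,
    K v = o (iter k promotion K w) :> nat &
    forall B, separated D B -> (v \in B) = (w \in B)].
Proof.
move=> modD labL; elim: k => [|k [o [o_top oP]]].
  exists id; split=> [i m -> _|K _ _ w wD]; first exact: addn0.
  by exists w.
have [o1 [o1_top o1P]] := promotion_origin modD (labeling_iter_promotion k labL).
exists (o \o o1); split=> [i m /= /o_top oi lt_km|K labK eqLK w wD].
  have oi' := oi (ltnW lt_km); rewrite addnS -addSn -oi'; congr (_ + _)%N.
  by case: (o1 i) (o1_top i) oi' => [|j] => [_|/(_ j erefl) -> //]; lia.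
have agk := iter_promotion_agree k modD labL labK eqLK.
have [v1 [v1D Kv1 v1B]] := o1P _ (labeling_iter_promotion k labK) agk w wD.
have [v [vD Kv vB]] := oP K labK eqLK v1 v1D.
exists v; split=> //; first by rewrite Kv Kv1.
by move=> B sepB; rewrite vB // v1B.
Qed.


(** With [o] from [iter_promotion_origin], the label is [a = o 0].  It is not the
    largest label, to whose slot belongs the label 1 after [#|P| - 2] steps. *)
Lemma endpos_origin D x L : (2 <= #|P|)%N -> lower_module D -> labeling L ->
  endpos x L \in D ->
  exists a, a <> #|P|.-1 /\ forall K, labeling K -> agree_outside D L K ->
  endpos x K \in D /\ exists v, [/\ v \in D, K v = a :> nat &
    forall B, separated D B -> (v \in B) = (endpos x K \in B)].
Proof.
move=> cardP modD labL eD.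
have [o [o_top oP]] := iter_promotion_origin #|P|.-2 modD labL.
exists (o 0); split=> [/o_top|K labK eqLK].
  by move=> H; have := H (leq_pred _); rewrite add0n; lia.
have eKD : endpos x K \in D.
  apply: contraTT eD => eKD; rewrite (@endposE x L (endpos x K)) //.
  by rewrite (iter_promotion_agree _ modD labL labK eqLK) // endposP.
split=> //; have [v [vD Kv vB]] := oP K labK eqLK _ eKD.
by exists v; split=> //; rewrite Kv endposP.
Qed.

Lemma agree_relabel (D : {set P}) u v L : u \in D -> v \in D ->
  agree_outside D L (relabel (tperm u v) L).
Proof.
move=> uD vD w wD; rewrite ffunE tpermD //.
  by apply: contraNneq wD => <-.
by apply: contraNneq wD => <-.
Qed.

Lemma prescribed_relabel (D : {set P}) z zb x L : z \in D -> zb \in D -> x \notin D ->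
  L \in prescribed zb x -> relabel (tperm z zb) L \in prescribed z x.
Proof.
move=> zD zbD xD; rewrite !inE => /and3P[labL Lz Lx].
rewrite relabel_labeling // -(agree_relabel L zD zbD xD) Lx.
by rewrite ffunE tpermL Lz.
Qed.

Section Swap.
Context (D B : {set P}) (x z zb : P).
Hypotheses (cardP : (2 <= #|P|)%N) (modD : lower_module D) (sepB : separated D B).
Hypotheses (BD : B \subset D) (zD : z \in D) (zB : z \notin B) (zbB : zb \in B).
Hypothesis (xD : x \notin D).

(** The slot label [a] of [endpos_origin] is carried by the same element of [B]
    before and after the exchange: that element is neither [z], which is outside
    of [B], nor [zb], which carries the largest label. *)
Lemma swap_endpos L : L \in prescribed zb x -> endpos x L \in B ->
  endpos x (relabel (tperm z zb) L) \in B.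
Proof.
rewrite inE => /and3P[labL /eqP Lz _] eB; have zbD := subsetP BD zb zbB.
have [a [neq_a aP]] := endpos_origin cardP modD labL (subsetP BD _ eB).
have [_ [v [vD Lv vB]]] := aP L labL (fun _ _ => erefl).
have labK := relabel_labeling (tperm z zb) labL.
have [_ [v' [v'D Kv' <- //]]] := aP _ labK (agree_relabel L zD zbD).
rewrite -vB // in eB; suff -> : v' = v by [].
apply: (label_inj labK); rewrite Kv' ffunE tpermD ?Lv //.
  by apply: contraNneq zB => ->.
by apply/eqP => zbv; apply: neq_a; rewrite -Lv -zbv Lz.
Qed.

(** A labeling with [a] at [zb] is never obtained: its preimage would carry [a]
    at [z], hence end outside of [B].  From a labeling that ends in [D], such a
    labeling is obtained by exchanging the labels at [zb] and at the element
    labelled [a]; one that ends outside of [D] is missed anyway. *)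
Lemma swap_missed : exists2 K, K \in prescribed z x &
  (endpos x K \in D -> endpos x K \in B) /\
  forall L, L \in prescribed zb x -> endpos x L \in B ->
    relabel (tperm z zb) L <> K.
Proof.
have zx : z != x by apply: contraNneq xD => <-.
have zbD := subsetP BD zb zbB.
have [K0 K0in] := prescribed_nonempty cardP zx.
have [eD|eD] := boolP (endpos x K0 \in D); last first.
  exists K0 => //; split=> [eD'|L Lin eB eqK]; first by rewrite eD' in eD.
  by move: eD; rewrite -eqK (subsetP BD) // swap_endpos.
move: (K0in); rewrite inE => /and3P[labK0 /eqP K0z /eqP K0x].
have [a [neq_a aP]] := endpos_origin cardP modD labK0 eD.
have [_ [w [wD K0w _]]] := aP K0 labK0 (fun _ _ => erefl).
have labK1 := relabel_labeling (tperm w zb) labK0.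
have agK1 := agree_relabel K0 wD zbD.
have K1zb : relabel (tperm w zb) K0 zb = a :> nat by rewrite ffunE tpermR.
exists (relabel (tperm w zb) K0).
  rewrite inE labK1 -(agK1 x xD) K0x eqxx andbT ffunE tpermD ?K0z ?eqxx //.
    by apply/eqP => wz; apply: neq_a; rewrite -K0w wz K0z.
  by apply: contraNneq zB => <-.
split=> [_|L Lin eB eqK].
  have [_ [v [vD K1v <- //]]] := aP _ labK1 agK1.
  by rewrite (@label_inj _ v zb labK1) // K1v K1zb.
have labL : labeling L by move: Lin; rewrite inE => /andP[].
have agL : agree_outside D K0 L.
  by move=> y yD; rewrite agK1 // -eqK -(agree_relabel L zD zbD).
have [_ [v [vD Lv vB]]] := aP L labL agL.
have vz : v = z.
  by apply: (label_inj labL); rewrite Lv -K1zb -eqK ffunE tpermR.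
by rewrite -vB // vz (negPf zB) in eB.
Qed.

End Swap.

End Promotion.

(** * Rooted forests *)

(** The unique cover of [q] is below every element above [q]; the claim follows
    by induction upwards. *)
Lemma rooted_forest_comparable {d : Order.disp_t} (Q : finPOrderType d) (q r s : Q) :
  rooted_forest Q -> q <= r -> q <= s -> r >=< s.
Proof.
case=> F [partF treeF sepF].
have [m] := ubnP #|[set y | q < y]|; elim: m q => // m IHm q lt_m.
rewrite le_eqVlt => /predU1P[->|qr]; first by move/le_comparable.
rewrite le_eqVlt => /predU1P[<-|qs]; first by apply/ge_comparable/ltW.
have inF t : pblock F t \in F by rewrite pblock_mem // (cover_partition partF) inE.
have inb t : t \in pblock F t by rewrite mem_pblock (cover_partition partF) inE.
have upb t : q < t -> t \in pblock F q.
  move=> qt; suff -> : pblock F q = pblock F t by [].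
  apply/eqP/negP => /negP/eqP neq.
  by have := sepF _ _ (inF q) (inF t) neq _ _ (inb q) (inb t); rewrite qt.
have [r0 [[/andP[_ /forall_inP max0] _] cov]] := treeF _ (inF q).
have [|y [/and4P[_ yA qy /forall_inP miny] uniy]] := cov q (inb q).
  by move=> q0; have := max0 r (upb r qr); rewrite -q0 qr.
have le_y t : q < t -> y <= t.
  move=> qt; have [t' [/andP[t'A qt'] t't mint]] := @ex_minimal_below _ Q
    (fun t => (t \in pblock F q) && (q < t)) t (introT andP (conj (upb t qt) qt)).
  rewrite (uniy t') //; apply/and4P; split=> //.
  by apply/forall_inP => c cA; apply/andP => -[qc /mint]; rewrite cA qc.
apply: (IHm y); rewrite ?le_y // -ltnS; apply: leq_trans lt_m.
rewrite ltnS; apply/proper_card/properP; split.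
  by apply/subsetP => t; rewrite !inE; apply: lt_trans.
by exists y; rewrite !inE ?qy ?ltxx.
Qed.

(** * Counting *)

Lemma card_le_sum_cover (I T : finType) (p : pred I) (F : I -> {set T}) (A : {set T}) :
  (forall t, t \in A -> exists2 i, p i & t \in F i) ->
  (#|A| <= \sum_(i | p i) #|F i|)%N.
Proof.
move=> covA; rewrite -sum1_card.
rewrite (eq_bigr (fun i => \sum_(t in T) (t \in F i))%N); last first.
  by move=> i _; rewrite -sum1_card big_mkcond.
rewrite exchange_big /= [leqRHS](bigID (mem A)) /=; apply: leq_trans (leq_addr _ _).
apply: leq_sum => t /covA[i pi ti]; rewrite (bigD1 i) //= ti.
exact: leq_addr.
Qed.

Lemma sum_card_disjoint (I T : finType) (p : pred I) (F : I -> {set T}) (A : {set T}) :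
  (forall i, p i -> F i \subset A) ->
  (forall i j t, p i -> p j -> t \in F i -> t \in F j -> i = j) ->
  (\sum_(i | p i) #|F i| <= #|A|)%N.
Proof.
move=> subA disj; rewrite -sum1_card.
rewrite (eq_bigr (fun i => \sum_(t in A) (t \in F i))%N); last first.
  move=> i pi; rewrite -sum1_card big_mkcond [RHS]big_mkcond /=.
  apply: eq_bigr => t _; case: ifP => [/(subsetP (subA i pi)) -> //|_].
  by case: ifP.
rewrite exchange_big /=; apply: leq_sum => t _.
have [i /andP[pi ti]|none] := pickP (fun i => p i && (t \in F i)).
  rewrite (bigD1 i) //= ti big1 // => j /andP[pj]; case tj: (t \in F j) => //.
  by rewrite (disj i j t) ?eqxx.
by rewrite big1 // => i pi; have := none i; rewrite pi => /= ->.
Qed.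

(** * Descending an inflated forest *)

Section InflatedForest.
Context {d d' : Order.disp_t} {P : finPOrderType d} {Q : finPOrderType d'}.
Context (phi : P -> Q) (x : P).
Hypotheses (cardP : (2 <= #|P|)%N) (inflP : inflation_map phi).
Hypothesis (forestQ : rooted_forest Q).
Implicit Types (q b c : Q) (u v w z : P) (L : prelabeling P).

Lemma inflation_lt u v : phi u < phi v -> u < v.
Proof.
case: inflP => _ _ lt_phi uv; apply/lt_phi => // eq_uv.
by rewrite eq_uv ltxx in uv.
Qed.

Lemma inflation_le u v : u <= v -> phi u <= phi v.
Proof.
case: inflP => _ _ lt_phi; rewrite le_eqVlt => /predU1P[-> //|uv].
by case: (eqVneq (phi u) (phi v)) => [-> //|/eqP neq]; apply/ltW/lt_phi.
Qed.

Lemma minimalP z : reflect (forall w, ~~ (w < z)) (minimal_in [set: P] z).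
Proof.
rewrite /minimal_in inE; apply: (iffP forall_inP) => [minz w|minz w _] //.
by apply: minz; rewrite inE.
Qed.

Lemma ex_minimal_le c : exists2 z, minimal_in [set: P] z & phi z <= c.
Proof.
case: inflP => /(_ c)[p pc] _ _.
have [z [_ zp minz]] := @ex_minimal_below _ P xpredT p isT.
exists z; last by rewrite -pc inflation_le.
by apply/minimalP => w; apply/negP => /minz.
Qed.

Lemma minimal_phi z q : minimal_in [set: P] z -> ~~ (q < phi z).
Proof.
case: inflP => /(_ q)[p <-] _ _ /minimalP/(_ p).
by apply: contra; apply: inflation_lt.
Qed.

Definition below c : {set P} := [set u | phi u < c].
Definition upto c : {set P} := [set u | phi u <= c].

Definition child b c : bool := (b < c) && [forall a, ~~ ((b < a) && (a < c))].

Lemma below_module c : lower_module (below c).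
Proof.
split=> [u v /ltW/inflation_le uv|u v w]; rewrite !inE; first exact: le_lt_trans.
move=> uc /ltW/inflation_le uv vc wc; apply: inflation_lt; apply: lt_le_trans wc _.
have := rooted_forest_comparable forestQ uv (ltW uc).
by rewrite comparable_sym => /comparable_leNgt ->.
Qed.

Lemma child_sup b c q : child b c -> b <= q -> q < c -> q = b.
Proof.
move=> /andP[_ /forallP/(_ q)]; rewrite le_eqVlt => nbc /predU1P[-> //|bq] qc.
by rewrite bq qc in nbc.
Qed.

Lemma child_eq a b c q : child a c -> child b c -> q <= a -> q <= b -> a = b.
Proof.
move=> ac bc qa qb; have [ltac _] := andP ac; have [ltbc _] := andP bc.
have /orP[ab|ba] := rooted_forest_comparable forestQ qa qb.
  by rewrite (child_sup ac ab ltbc).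
by rewrite (child_sup bc ba ltac).
Qed.

Lemma ex_child q c : q < c -> exists2 b, child b c & q <= b.
Proof.
move=> qc; have [b [bc qb maxb]] := @ex_maximal_above _ Q (fun b => b < c) q qc.
exists b => //; rewrite /child bc; apply/forallP => a; apply/andP => -[/maxb].
by move/negP.
Qed.

Lemma upto_separated b c : child b c -> separated (below c) (upto b).
Proof.
move=> bc u v; rewrite !inE => uc vc /ltW/inflation_le uv.
apply/idP/idP => [ub|]; last exact: le_trans.
have /orP[//|bv] := rooted_forest_comparable forestQ uv ub.
by rewrite (child_sup bc bv vc).
Qed.

Lemma upto_below b c : child b c -> upto b \subset below c.
Proof.
by move=> /andP[bc _]; apply/subsetP => u; rewrite !inE => /le_lt_trans; apply.
Qed.

(** The labelings that pass the necessary condition of [tangled_endpos] for some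
    minimal [z] over the nodes up to [c]. *)
Definition candidates c : {set prelabeling P} :=
  [set L | [exists z, [&& minimal_in [set: P] z, phi z <= c,
    L \in prescribed z x & z < endpos x L]]].

(** For the induction, [reaching] also admits final positions above [c]: when
    only one element lies over the nodes up to [c], it carries the largest label
    and the second largest one stays above it. *)
Definition reaching c z : {set prelabeling P} :=
  [set L in prescribed z x | phi (endpos x L) >=< c].

Definition entering c z : {set prelabeling P} :=
  [set L in prescribed z x | phi (endpos x L) <= c].

Lemma candidatesP c L : reflect (exists z, [/\ minimal_in [set: P] z, phi z <= c,
  L \in prescribed z x & z < endpos x L]) (L \in candidates c).
Proof. by rewrite inE; apply: (iffP existsP) => -[z /and4P]; exists z. Qed.

Lemma minimal_below c z : (exists q, q < c) -> minimal_in [set: P] z ->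
  phi z <= c -> phi z < c.
Proof.
move=> [q qc] minz; rewrite le_eqVlt => /predU1P[zc|//].
by have := minimal_phi q minz; rewrite zc qc.
Qed.

Lemma reaching_child b c z : child b c -> reaching b z \subset reaching c z.
Proof.
move=> /andP[bc _]; apply/subsetP => L; rewrite !inE => /andP[-> /orP[eb|be]] /=.
  by rewrite le_comparable // (le_trans eb (ltW bc)).
exact: rooted_forest_comparable forestQ be (ltW bc).
Qed.

Section Branching.
Context (b0 b1 c : Q) (z : P).
Hypotheses (b0c : child b0 c) (b1c : child b1 c) (neq_b : b0 != b1).
Hypotheses (cx : c <= phi x) (minz : minimal_in [set: P] z) (zb0 : phi z <= b0).
Hypothesis (IHc : forall b zb, child b c -> minimal_in [set: P] zb ->
  phi zb <= b -> (#|candidates b| <= #|reaching b zb|)%N).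

Let xD : x \notin below c.
Proof. by rewrite inE le_gtF. Qed.

Let zD : z \in below c.
Proof. by rewrite inE (le_lt_trans zb0) //; case/andP: b0c. Qed.

(** With two children there are two minimal elements over the nodes below [c],
    and [below_endpos] excludes a final position above both. *)
Lemma reaching_entering b zb : child b c -> reaching b zb \subset entering b zb.
Proof.
move=> bc; apply/subsetP => L; rewrite !inE => /andP[inL]; rewrite inL /=.
move=> /orP[//|be]; have [ltbc _] := andP bc.
have labL : labeling L by case/andP: inL.
suff /negP ce : ~~ (c <= phi (endpos x L)).
  have /orP[ec|//] := rooted_forest_comparable forestQ be (ltW ltbc).
  rewrite (child_sup bc be) // lt_neqAle ec andbT.
  by apply/eqP => ec'; apply: ce; rewrite ec'.
apply/negP => ce; have [z0 _ z0b0] := ex_minimal_le b0.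
have [z1 _ z1b1] := ex_minimal_le b1.
have below_e a w : child a c -> phi w <= a -> w < endpos x L.
  move=> /andP[ac _] wa; apply: inflation_lt.
  exact: le_lt_trans wa (lt_le_trans ac ce).
have z01 := below_endpos cardP labL (below_e _ _ b0c z0b0) (below_e _ _ b1c z1b1).
by move: neq_b; rewrite (child_eq b0c b1c z0b0) ?eqxx // z01.
Qed.

Lemma entering_swap b zb L : child b c -> ~~ (phi z <= b) -> phi zb <= b ->
  L \in entering b zb -> relabel (tperm z zb) L \in entering b z.
Proof.
move=> bc zb_nle zbb; rewrite inE => /andP[inL eb].
have zbD : zb \in below c by apply: (subsetP (upto_below bc)); rewrite inE.
rewrite inE (prescribed_relabel zD zbD xD inL) /=.
have := @swap_endpos _ P (below c) (upto b) x z zb cardP (below_module c)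
  (upto_separated bc) (upto_below bc) zD _ _ L inL.
by rewrite !inE => ->.
Qed.

Lemma candidates_entering b : child b c -> (#|candidates b| <= #|entering b z|)%N.
Proof.
move=> bc; have [zb|zb_nle] := boolP (phi z <= b).
  exact: leq_trans (IHc bc minz zb) (subset_leq_card (reaching_entering z bc)).
have [zb minzb zbb] := ex_minimal_le b.
apply: leq_trans (IHc bc minzb zbb) _.
apply: leq_trans (subset_leq_card (reaching_entering zb bc)) _.
rewrite -(card_imset _ (@relabel_inj _ _ (tperm z zb))).
apply/subset_leq_card/subsetP => _ /imsetP[L inL ->].
exact: entering_swap.
Qed.

Lemma candidates_children :
  (#|candidates c| <= \sum_(b | child b c) #|candidates b|)%N.
Proof.
apply: card_le_sum_cover => L /candidatesP[z' [minz' z'c inL z'e]].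
have [b bc z'b] := ex_child (minimal_below (ex_intro _ b0 (proj1 (andP b0c))) minz' z'c).
by exists b => //; apply/candidatesP; exists z'.
Qed.

Lemma candidates_sum_entering :
  (#|candidates c| <= \sum_(b | child b c) #|entering b z|)%N.
Proof.
apply: leq_trans candidates_children _.
by apply: leq_sum => b; apply: candidates_entering.
Qed.

Lemma entering_disjoint b b' L : child b c -> child b' c ->
  L \in entering b z -> L \in entering b' z -> b = b'.
Proof.
by move=> bc b'c; rewrite !inE => /andP[_ eb] /andP[_ eb']; apply: (child_eq bc b'c eb).
Qed.

Lemma branching_le : (#|candidates c| <= #|reaching c z|)%N.
Proof.
apply: leq_trans candidates_sum_entering _.
apply: sum_card_disjoint => [b /andP[bc _]|b b' L]; last exact: entering_disjoint.
apply/subsetP => L; rewrite !inE => /andP[-> eb].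
by rewrite le_comparable // (le_trans eb (ltW bc)).
Qed.

(** The labeling [K] missed by the exchange for [b1] either ends in no component
    at all, or makes the bound for the component of [b1] strict. *)
Lemma branching_lt : (#|candidates c| < #|prescribed z x|)%N.
Proof.
have zb1 : ~~ (phi z <= b1).
  by apply: contra neq_b => zb1; rewrite (child_eq b0c b1c zb0 zb1).
have [z1 minz1 z1b1] := ex_minimal_le b1.
have [||K inK [KD missK]] := @swap_missed _ P (below c) (upto b1) x z z1 cardP
  (below_module c) (upto_separated b1c) (upto_below b1c) zD _ _ xD.
- by rewrite inE.
- by rewrite inE.
have sub_entering b : entering b z \subset prescribed z x.
  by apply/subsetP => L; rewrite inE => /andP[].
have [eD|eD] := boolP (endpos x K \in below c); last first.
  apply: leq_ltn_trans candidates_sum_entering _.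
  apply: leq_ltn_trans (_ : _ <= #|prescribed z x :\ K|)%N _; last first.
    by rewrite [X in (_ < X)%N](cardsD1 K) inK.
  apply: sum_card_disjoint => [b bc|b b' L]; last exact: entering_disjoint.
  rewrite subsetD1 sub_entering /=; apply: contra eD; rewrite inE => /andP[_ eb].
  by apply: (subsetP (upto_below bc)); rewrite inE.
have lt_b1 : (#|candidates b1| < #|entering b1 z|)%N.
  apply: leq_ltn_trans (IHc b1c minz1 z1b1) _.
  apply: leq_ltn_trans (subset_leq_card (reaching_entering z1 b1c)) _.
  rewrite -(card_imset _ (@relabel_inj _ _ (tperm z z1))).
  apply/proper_card/properP; split.
    by apply/subsetP => _ /imsetP[L inL ->]; apply: entering_swap.
  exists K; first by move: (KD eD); rewrite !inE in inK * => ->; rewrite inK.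
  apply/imsetP => -[L]; rewrite inE => /andP[inL eb] /esym.
  by apply: missK => //; rewrite inE.
apply: leq_ltn_trans candidates_children _.
apply: leq_trans (_ : (\sum_(b | child b c) #|entering b z|) <= _)%N; last first.
  by apply: sum_card_disjoint => // b b' L; apply: entering_disjoint.
rewrite (bigD1 b1) // [leqRHS](bigD1 b1) //= -addSn leq_add //.
by apply: leq_sum => b /andP[bc _]; apply: candidates_entering.
Qed.

End Branching.

Lemma candidates_single_child b c : child b c ->
  (forall b', child b' c -> b' = b) -> candidates c \subset candidates b.
Proof.
move=> bc unib; apply/subsetP => L /candidatesP[z [minz zc inL ze]].
have [b' /unib -> zb] :=
  ex_child (minimal_below (ex_intro _ b (proj1 (andP bc))) minz zc).
by apply/candidatesP; exists z.
Qed.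

(** The block over a minimal node has a single minimal element. *)
Lemma minimal_block_eq c z z' : (forall q, ~~ (q < c)) ->
  minimal_in [set: P] z -> minimal_in [set: P] z' ->
  phi z <= c -> phi z' <= c -> z = z'.
Proof.
move=> minc minz minz'; rewrite !le_eqVlt !(negPf (minc _)) !orbF => /eqP zc /eqP z'c.
case: inflP => _ /(_ c)[m [_ unim]] _.
have in_block w : minimal_in [set: P] w -> phi w = c ->
    minimal_in (phi @^-1: [set c]) w.
  move=> /minimalP minw wc; rewrite /minimal_in !inE wc eqxx.
  by apply/forall_inP => y _; apply: minw.
by rewrite -(unim z) ?(unim z') //; apply: in_block.
Qed.

(** Both bounds pass from the only child of [c] to [c] itself; at a branching
    node they come from [branching_le] and [branching_lt]. *)
Lemma candidates_bound c : c <= phi x ->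
  (forall z, minimal_in [set: P] z -> phi z <= c ->
    (#|candidates c| <= #|reaching c z|)%N) /\
  (forall z z', minimal_in [set: P] z -> minimal_in [set: P] z' -> z != z' ->
    phi z <= c -> phi z' <= c -> (#|candidates c| < (#|P| - 2)`!)%N).
Proof.
have [m] := ubnP #|[set q | q < c]|; elim: m c => // m IHm c lt_m cx.
have lt_card b : child b c -> (#|[set q | (q < b)%O]| < m)%N.
  move=> /andP[bc _]; rewrite -ltnS; apply: leq_trans lt_m; rewrite ltnS.
  apply/proper_card/properP; split.
    by apply/subsetP => q; rewrite !inE => /lt_trans; apply.
  by exists b; rewrite !inE ?ltxx.
have child_le b : child b c -> b <= phi x by case/andP => /ltW/le_trans ->.
have IHc b (bc : child b c) := IHm b (lt_card b bc) (child_le b bc).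
have [q qc|minc] := pickP (fun q => q < c); last first.
  have eq_min := @minimal_block_eq c _ _ (fun q => negbT (minc q)).
  split=> [z minz zc|z z' minz minz' neq zc z'c]; last first.
    by move: neq; rewrite (eq_min z z') ?eqxx.
  apply/subset_leq_card/subsetP => L /candidatesP[z' [minz' z'c inL ze]].
  rewrite (eq_min z' z) // in inL ze; have {}ze := inflation_le (ltW ze).
  rewrite inE inL /=.
  have -> : c = phi z by apply/esym/eqP; move: zc; rewrite le_eqVlt minc orbF.
  by rewrite ge_comparable.
have ex_child_min z : minimal_in [set: P] z -> phi z <= c ->
    exists2 b, child b c & phi z <= b.
  by move=> minz zc; apply/ex_child/minimal_below => //; exists q.
split=> [z minz /(ex_child_min z minz)[b0 b0c zb0]|].
  have [b1 /andP[b1c neq_b]|one] := pickP (fun b => child b c && (b0 != b)).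
    exact: (branching_le b0c b1c neq_b cx minz zb0 (fun b zb bc => (IHc b bc).1 zb)).
  have sub_b0 : candidates c \subset candidates b0.
    apply: candidates_single_child => // b bc.
    by move: (one b); rewrite bc => /= /negbFE/eqP.
  apply: leq_trans (subset_leq_card sub_b0) _.
  apply: leq_trans ((IHc b0 b0c).1 z minz zb0) (subset_leq_card _).
  exact: reaching_child.
move=> z z' minz minz' neq /(ex_child_min z minz)[b0 b0c zb0].
move=> /(ex_child_min z' minz')[b1 b1c z'b1].
have [b /andP[bc neq_b]|one] := pickP (fun b => child b c && (b0 != b)).
  rewrite -(@card_prescribed _ P z x) //.
    exact: (branching_lt b0c bc neq_b cx minz zb0 (fun b zb bc => (IHc b bc).1 zb)).
  apply: contraTneq cx => <-; rewrite lt_geF //.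
  by apply: le_lt_trans zb0 _; case/andP: b0c.
have eq_b0 b : child b c -> b = b0.
  by move=> bc; move: (one b); rewrite bc => /= /negbFE/eqP.
apply: leq_ltn_trans (subset_leq_card (candidates_single_child b0c eq_b0)) _.
by apply: (IHc b0 b0c).2 minz minz' neq zb0 _; rewrite -(eq_b0 b1).
Qed.

Lemma tangled_candidates : tangled_at x \subset candidates (phi x).
Proof.
apply/subsetP => L /(tangled_endpos cardP)[z [minz inL ze]].
apply/candidatesP; exists z; split=> //; apply/inflation_le/ltW.
exact: lt_le_trans ze (endpos_le cardP inL).
Qed.

End InflatedForest.

Theorem theorem3p14 (d : Order.disp_t) (P : finPOrderType d) (n : nat)
    (cardP : #|P| = n) (n_ge2 : (2 <= n)%N)
    (forestP : inflated_rooted_forest P) (x : P) :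
  (#|tangled_at x| <= (n - 2)`!)%N /\
  (#|tangled_at x| = (n - 2)`! <->
   exists! z : P, minimal_in [set: P] z /\ z < x).
Proof.
case: forestP => d' [Q [forestQ [phi inflP]]].
rewrite -cardP in n_ge2 *.
have [[z z'] /and5P[minz zx minz' z'x neq]|not_two] := pickP (fun p : P * P =>
  [&& minimal_in [set: P] p.1, p.1 < x, minimal_in [set: P] p.2, p.2 < x & p.1 != p.2]).
  have lt_T : (#|tangled_at x| < (#|P| - 2)`!)%N.
    apply: leq_ltn_trans (subset_leq_card (tangled_candidates x n_ge2 inflP)) _.
    apply: (candidates_bound n_ge2 inflP forestQ (lexx (phi x))).2 minz minz' neq _ _.
      exact/(inflation_le inflP)/ltW.
    exact/(inflation_le inflP)/ltW.
  split; first exact: ltnW.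
  split=> [eq_T|[z0 [_ uniz]]]; first by rewrite eq_T ltnn in lt_T.
  by move: neq; rewrite /= -(uniz z) // -(uniz z') ?eqxx.
have [z /andP[minz zx]|no_min] := pickP (fun z => minimal_in [set: P] z && (z < x)).
  have uniz w : minimal_in [set: P] w -> w < x -> w = z.
    move=> minw wx; apply/eqP; have := not_two (w, z).
    by rewrite /= minw wx minz zx /= => /negbFE.
  have -> : tangled_at x = prescribed z x.
    apply/setP => L; apply/idP/idP; last exact: tangled_unique_minimal.
    move/(tangled_endpos n_ge2) => [w [minw inL we]].
    by rewrite -(uniz w) // (lt_le_trans we) // (endpos_le n_ge2 inL).
  rewrite card_prescribed // ?(lt_eqF zx) //; split=> //; split=> // _.
  by exists z; split=> // w [minw wx]; rewrite (uniz w).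
have -> : #|tangled_at x| = 0.
  apply: eq_card0 => L; apply/negP => /(tangled_endpos n_ge2)[z [minz inL ze]].
  have := no_min z; rewrite minz (lt_le_trans ze) //.
  exact: endpos_le n_ge2 inL.
split=> //; split=> [eq0|[z [[minz zx] _]]].
  by have := fact_gt0 (#|P| - 2); rewrite -eq0.
by have := no_min z; rewrite minz zx.
Qed.
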